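(* Let $k \ge 1$ be an integer and let $G_k = \langle x_1, x_2, \ldots, x_k \mid x_i x_j x_i^{-1} x_j \text{ for all } i < j \rangle$ (so $G_1 = \mathbb{Z}$). Then for every positive integer $n$, the number $m_n(G_k)$ of maximal subgroups of $G_k$ of index $n$ is $$m_n(G_k) = \begin{cases} 1 + (k-1)n & \text{if } n \text{ is a prime with } n > 2,\\ \sum_{j=0}^{k-1} 2^j & \text{if } n = 2,\\ 0 & \text{if } n \text{ is not prime.} \end{cases}$$
   Context: For a finitely generated group $G$ and a positive integer $n$, $m_n(G)$ denotes the number of maximal subgroups of $G$ of index $n$. In the presentation of $G_k$ the indices $i,j$ range over $1 \le i < j \le k$; the relations say $x_i x_j x_i^{-1} = x_j^{-1}$ for $i<j$. *)

(* Defs.v *)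
From HB Require Import structures.
From mathcomp Require Import all_boot.
From mathcomp Require Import boolp classical_sets functions cardinality.

Set Implicit Arguments.
Unset Strict Implicit.
Unset Printing Implicit Defensive.

Local Open Scope quotient_scope.
Local Open Scope classical_set_scope.
Local Open Scope card_scope.

(* A letter (t, true) stands for the generator t, (t, false) for its formal
   inverse. *)
Definition letter (T : Type) : Type := (T * bool)%type.
Definition word (T : Type) : Type := seq (letter T).
HB.instance Definition _ (T : choiceType) := Choice.on (letter T).
HB.instance Definition _ (T : choiceType) := Choice.on (word T).

Definition inv_letter (T : Type) (a : letter T) : letter T := (a.1, ~~ a.2).
Definition inv_word (T : Type) (w : word T) : word T :=
  rev (map (@inv_letter T) w).

Section Presentation.
Variables (T : choiceType) (R : set (word T)).

(* Inserting or deleting a a^-1 or a relator at any position generates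
   equality in < T | R >. *)
Inductive pres_equiv : word T -> word T -> Prop :=
| pres_refl u : pres_equiv u u
| pres_sym u v : pres_equiv u v -> pres_equiv v u
| pres_trans v u w : pres_equiv u v -> pres_equiv v w -> pres_equiv u w
| pres_cancel u a v : pres_equiv (u ++ a :: inv_letter a :: v) (u ++ v)
| pres_relator u r v : R r -> pres_equiv (u ++ r ++ v) (u ++ v).

Definition pres_equivb (u v : word T) : bool := `[< pres_equiv u v >].

Lemma pres_equivb_refl : reflexive pres_equivb.
Proof. by move=> u; apply/asboolP; apply: pres_refl. Qed.

Lemma pres_equivb_sym : symmetric pres_equivb.
Proof. by move=> u v; apply/asboolP/asboolP; apply: pres_sym. Qed.

Lemma pres_equivb_trans : transitive pres_equivb.
Proof.
by move=> v u w /asboolP uv /asboolP vw; apply/asboolP; apply: pres_trans vw.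
Qed.

Canonical pres_equiv_rel : equiv_rel (word T) :=
  EquivRel pres_equivb pres_equivb_refl pres_equivb_sym pres_equivb_trans.

Definition presented_group : Type := {eq_quot pres_equiv_rel}.
HB.instance Definition _ := Choice.on presented_group.

Definition pres_class (u : word T) : presented_group :=
  \pi_({eq_quot pres_equiv_rel}) u.
Definition pres_repr (g : presented_group) : word T :=
  repr (g : {eq_quot pres_equiv_rel}).

Definition pres_gen (t : T) : presented_group := pres_class [:: (t, true)].
Definition pres_one : presented_group := pres_class [::].
Definition pres_mul (g h : presented_group) : presented_group :=
  pres_class (pres_repr g ++ pres_repr h).
Definition pres_inv (g : presented_group) : presented_group :=
  pres_class (inv_word (pres_repr g)).

Lemma pres_reprK (g : presented_group) : pres_class (pres_repr g) = g.
Proof. exact: reprK. Qed.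

Lemma pres_classP u v : pres_class u = pres_class v <-> pres_equiv u v.
Proof.
split=> [/eqmodP /asboolP //|uv].
by apply/eqmodP; apply/asboolP.
Qed.

Lemma pres_equiv_ctx p q u v :
  pres_equiv u v -> pres_equiv (p ++ u ++ q) (p ++ v ++ q).
Proof.
elim=> {u v} [u|u v _|v u w _ uv _ vw|u a v|u r v Rr].
- exact: pres_refl.
- exact: pres_sym.
- exact: pres_trans vw.
- rewrite -!catA !cat_cons !(catA p u); exact: pres_cancel.
- rewrite -!catA !(catA p u); exact: pres_relator.
Qed.

Lemma pres_equiv_cat u u' v v' :
  pres_equiv u u' -> pres_equiv v v' -> pres_equiv (u ++ v) (u' ++ v').
Proof.
move=> uu' vv'; apply: (@pres_trans (u' ++ v)).
  exact: (pres_equiv_ctx [::] v uu').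
by have := pres_equiv_ctx u' [::] vv'; rewrite !cats0.
Qed.

Lemma pres_equiv_mulV u : pres_equiv (u ++ inv_word u) [::].
Proof.
elim/last_ind: u => [|u a IHu]; first exact: pres_refl.
rewrite /inv_word map_rcons rev_rcons cat_rcons.
exact: pres_trans (pres_cancel _ _ _) IHu.
Qed.

Lemma inv_wordK : involutive (@inv_word T).
Proof.
move=> u; rewrite /inv_word map_rev revK -map_comp map_id_in // => -[t b] _.
by rewrite /inv_letter /= negbK.
Qed.

Lemma pres_class_mul u v :
  pres_mul (pres_class u) (pres_class v) = pres_class (u ++ v).
Proof.
by apply/pres_classP/pres_equiv_cat; apply/pres_classP; rewrite pres_reprK.
Qed.

Lemma pres_mulA : associative pres_mul.
Proof.
move=> f g h; rewrite -[f]pres_reprK -[g]pres_reprK -[h]pres_reprK.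
by rewrite !pres_class_mul catA.
Qed.

Lemma pres_mul1 : left_id pres_one pres_mul.
Proof. by move=> g; rewrite -[g]pres_reprK pres_class_mul. Qed.

Lemma pres_mulr1 : right_id pres_one pres_mul.
Proof. by move=> g; rewrite -[g]pres_reprK pres_class_mul cats0. Qed.

Lemma pres_mulrV : right_inverse pres_one pres_inv pres_mul.
Proof.
move=> g; rewrite -[g in LHS]pres_reprK pres_class_mul pres_reprK.
exact/pres_classP/pres_equiv_mulV.
Qed.

Lemma pres_mulVr : left_inverse pres_one pres_inv pres_mul.
Proof.
move=> g; rewrite -[X in pres_mul _ X]pres_reprK pres_class_mul.
by apply/pres_classP; rewrite -[X in _ ++ X]inv_wordK; apply: pres_equiv_mulV.
Qed.

HB.instance Definition _ := isGroup.Build presented_group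
  pres_mulA pres_mul1 pres_mulr1 pres_mulVr pres_mulrV.

End Presentation.

Section Subgroups.
Local Open Scope group_scope.
Variable G : groupType.

Definition subgroup (H : set G) : Prop := group_closed [in H].

Definition maximal_subgroup (H : set G) : Prop :=
  [/\ subgroup H, H <> [set: G] &
      forall K : set G, subgroup K -> H `<=` K -> K = H \/ K = [set: G]].

Definition left_cosets (H : set G) : set (set G) :=
  [set [set g * h | h in H] | g in [set: G]].

(* Meant for positive n only: no subgroup has index 0 in this sense. *)
Definition has_index (H : set G) (n : nat) : Prop := left_cosets H #= `I_n.

Definition maximal_subgroups_of_index (n : nat) : set (set G) :=
  [set H | maximal_subgroup H /\ has_index H n].

(* The number of maximal subgroups of index n exists and is m. *)
Definition m_is (n m : nat) : Prop := maximal_subgroups_of_index n #= `I_m.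

End Subgroups.

Arguments m_is : clear implicits.
Arguments maximal_subgroups_of_index : clear implicits.

(* The relators x_i x_j x_i^-1 x_j, with indices running from 0. *)
Definition Gk_relators (k : nat) : set (word 'I_k) :=
  [set w | exists i j : 'I_k,
     (i < j)%N /\ w = [:: (i, true); (j, true); (i, false); (j, true)]].

Definition Gk (k : nat) : groupType := presented_group (@Gk_relators k).

(* Main.v *)
(* Let M be a maximal subgroup of finite index, j the last index with x_j not in
   M, and N the normal subgroup generated by the x_i with i > j, so that N lies
   in M.  Modulo N every element of G_k commutes with x_j or inverts it, hence
   <x_j^s> M is a subgroup for every s.  By maximality it is M or G_k, which
   forces the index p of M to be prime and the cosets of M to be
   M, x_j M, ..., x_j^(p-1) M.  Identifying them with F_p, the generator x_i acts
   as the identity for i > j, as t |-> t + 1 for i = j, and as t |-> d_i - t for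
   i < j; the relations amount to 2 d_i = 2 d_i' for i, i' < j.  Conversely,
   every such (j, d) defines an action on F_p, and the stabilizers of 0 are
   distinct maximal subgroups of index p.  For p odd there is one pair with j = 0
   and there are p for each j > 0; for p = 2 there are 2^j for each j. *)

Require Import Defs.
From mathcomp Require Import all_boot all_algebra.
From mathcomp Require Import ring.
From mathcomp Require Import boolp classical_sets functions cardinality.

Set Implicit Arguments.
Unset Strict Implicit.
Unset Printing Implicit Defensive.

Local Open Scope classical_set_scope.
Local Open Scope card_scope.

(** * Subgroups, left cosets and index *)

Section SubgroupLemmas.
Local Open Scope group_scope.
Variables (G : groupType) (H : set G).

Lemma subgroupP : subgroup H <-> H 1 /\ forall g h, H g -> H h -> H (g / h).
Proof.
split=> [[H1 HV]|[H1 HV]].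
  split=> [|g h Hg Hh]; first by move: H1; rewrite in_setE.
  by have := HV g h; rewrite !in_setE; apply.
by split=> [|g h]; rewrite !in_setE //; apply: HV.
Qed.

Hypothesis sgH : subgroup H.

Lemma subgroup1 : H 1.
Proof. by case/subgroupP: sgH. Qed.

Lemma subgroupV g : H g -> H g^-1.
Proof. by case/subgroupP: sgH => H1 HV /(HV _ _ H1); rewrite mul1g. Qed.

Lemma subgroupM g h : H g -> H h -> H (g * h).
Proof.
by move=> Hg /subgroupV Hh; case/subgroupP: sgH => _ /(_ _ _ Hg Hh); rewrite invgK.
Qed.

Lemma subgroupMl g h : H g -> H (g * h) <-> H h.
Proof.
move=> Hg; split=> [Hgh|]; last exact: subgroupM.
by rewrite -(mulKg g h); apply: subgroupM => //; apply: subgroupV.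
Qed.

Lemma subgroupMr g h : H h -> H (g * h) <-> H g.
Proof.
move=> Hh; split=> [Hgh|Hg]; last exact: subgroupM.
by rewrite -(mulgK h g); apply: subgroupM => //; apply: subgroupV.
Qed.

Lemma subgroupX g m : H g -> H (g ^+ m).
Proof.
move=> Hg; elim: m => [|m IHm]; first exact: subgroup1.
by rewrite expgS; apply: subgroupM.
Qed.

Definition eqcoset g h := H (g^-1 * h).

Lemma eqcoset_refl g : eqcoset g g.
Proof. by rewrite /eqcoset mulVg; apply: subgroup1. Qed.

Lemma eqcoset_sym g h : eqcoset g h -> eqcoset h g.
Proof. by move/subgroupV; rewrite invgM invgK. Qed.

Lemma eqcoset_trans h g f : eqcoset g h -> eqcoset h f -> eqcoset g f.
Proof. by move=> gh hf; have := subgroupM gh hf; rewrite mulgA mulgK. Qed.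

Lemma eqcosetMl f g h : eqcoset (f * g) (f * h) <-> eqcoset g h.
Proof. by rewrite /eqcoset invgM mulgA mulgVK. Qed.

Lemma eqcosetMr g h : H h -> eqcoset g (g * h).
Proof. by rewrite /eqcoset mulKg. Qed.

Lemma left_cosetP f g : [set f * h | h in H] g <-> eqcoset f g.
Proof.
split=> [[h Hh <-]|fg]; first exact: eqcosetMr.
by exists (f^-1 * g); rewrite ?mulVKg.
Qed.

Lemma left_coset_eq f g :
  [set f * h | h in H] = [set g * h | h in H] <-> eqcoset f g.
Proof.
split=> [fg|fg]; first by apply/left_cosetP; rewrite fg; apply/left_cosetP/eqcoset_refl.
apply/seteqP; split=> y /left_cosetP ay; apply/left_cosetP.
  exact: eqcoset_trans (eqcoset_sym fg) ay.
exact: eqcoset_trans fg ay.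
Qed.

Lemma has_index_transversal n (t : nat -> G) :
    (forall g, exists2 a, (a < n)%N & eqcoset (t a) g) ->
    (forall a b, (a < n)%N -> (b < n)%N -> eqcoset (t a) (t b) -> a = b) ->
  has_index H n.
Proof.
move=> surj_t inj_t; rewrite /has_index.
have -> : left_cosets H = (fun a => [set t a * h | h in H]) @` `I_n.
  apply/seteqP; split=> [_ [g _ <-]|_ [a _ <-]]; last by exists (t a).
  by have [a lt_a_n tag] := surj_t g; exists a => //; apply/left_coset_eq.
apply: inj_card_eq => a b; rewrite !in_setE => lt_a lt_b /left_coset_eq.
exact: inj_t.
Qed.

(** Pigeonhole: the [n + 1] cosets of [x^0, ..., x^n] cannot all differ, and the difference of two
    exponents with the same coset serves as [s]. *)
Lemma has_index_power n x : has_index H n -> exists2 s, (0 < s)%N & H (x ^+ s).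
Proof.
move=> /card_set_bijP-[f [fI finj _]].
have lt_f (a : nat) : (f [set (x ^+ a * h)%g | h in H] < n)%N.
  by apply: fI; exists (x ^+ a).
pose F (a : 'I_n.+1) := Ordinal (lt_f a).
have /injectivePn[a [b neq_ab /(congr1 val) /= eqf]] : ~~ injectiveb F.
  by apply/negP => /injectiveP/leq_card; rewrite !card_ord ltnn.
have {eqf} ab : eqcoset (x ^+ a) (x ^+ b).
  apply/left_coset_eq; apply: finj eqf; rewrite inE; [by exists (x ^+ a)|by exists (x ^+ b)].
wlog lt_ab : a b {neq_ab} ab / (a < b)%N.
  move=> wlg; case: (ltngtP a b) => [||/val_inj eq_ab]; [exact: wlg| |].
    by apply: wlg; apply: eqcoset_sym.
  by rewrite eq_ab eqxx in neq_ab.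
exists (b - a)%N; first by rewrite subn_gt0.
by move: ab; rewrite /eqcoset -{1}(subnKC (ltnW lt_ab)) expgnDr mulKg.
Qed.

End SubgroupLemmas.

Lemma has_index_inj (G : groupType) (H : set G) m n :
  has_index H m -> has_index H n -> m = n.
Proof.
move=> Hm Hn; apply/card_eq_II; apply: card_eq_trans Hn.
by rewrite card_eq_sym.
Qed.

(** For [p > 0] this says that [1, x, ..., x^(p-1)] represent every left coset of [H] exactly
    once. *)
Definition cyclic_transversal (G : groupType) (H : set G) (x : G) (p : nat) :=
  (forall g, exists t, eqcoset H (x ^+ t)%g g) /\
  (forall t, H (x ^+ t)%g <-> p %| t).

(** * Subgroups whose cosets are represented by powers of one element *)

Section CyclicTransversal.
Local Open Scope group_scope.
Variables (G : groupType) (H : set G) (x : G) (p : nat).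
Hypotheses (sgH : subgroup H) (Hxp : cyclic_transversal H x p).

Lemma eqcoset_expg a b :
  eqcoset H (x ^+ a) (x ^+ b) <-> a = b %[mod p].
Proof.
wlog le_ab : a b / (a <= b)%N.
  move=> wlg; have [/wlg //|/ltnW/wlg ba] := leqP a b.
  by split=> [/(eqcoset_sym sgH)/ba//|/esym/ba/(eqcoset_sym sgH)].
rewrite /eqcoset -{1}(subnKC le_ab) expgnDr mulKg; case: Hxp => _ ->.
by rewrite -eqn_mod_dvd // eq_sym; split=> [/eqP|->].
Qed.

Lemma cyclic_transversal_index : (0 < p)%N -> has_index H p.
Proof.
move=> p_gt0; apply: (@has_index_transversal _ _ sgH _ (fun t => x ^+ t)).
  move=> g; have [t xt] := Hxp.1 g; exists (t %% p)%N; first by rewrite ltn_mod.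
  by apply: (eqcoset_trans sgH) xt; apply/eqcoset_expg; rewrite modn_mod.
by move=> a b lt_a lt_b /eqcoset_expg; rewrite !modn_small.
Qed.

(** A subgroup [K] strictly above [H] contains some [x^t] with [t] prime to [p]. It also contains
    [x^p], hence [x], and then every coset. *)
Lemma cyclic_transversal_maximal : prime p -> maximal_subgroup H.
Proof.
move=> p_pr; split=> //.
  move=> HT; have : H (x ^+ 1) by rewrite HT.
  by case: Hxp => _ ->; rewrite dvdn1 => /eqP p1; rewrite p1 in p_pr.
move=> K sgK sHK; have [->|neqKH] := pselect (K = H); [by left|right].
have [g Kg nHg] : exists2 g, K g & ~ H g.
  apply: contrapT => nex; apply: neqKH; apply/seteqP; split=> // g Kg.
  by apply: contrapT => nHg; apply: nex; exists g.
have [t xt] := Hxp.1 g.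
have Kt : K (x ^+ t).
  rewrite -(mulVKg g (x ^+ t)); apply: subgroupM => //.
  exact/sHK/(eqcoset_sym sgH).
have ndvd : ~~ (p %| t).
  by apply/negP => /(Hxp.2 t) Ht; apply: nHg; rewrite -(mulVKg (x ^+ t) g); apply: subgroupM.
have Kx : K x.
  have t_gt0 : (0 < t)%N by case: t ndvd {xt Kt} => //; rewrite dvdn0.
  (* Bezout over the naturals: [u * t = v * p + 1], so [x^(v * p) * x] is a power of [x^t]. *)
  case: (egcdnP p t_gt0) => u v uv _.
  have gcd1 : gcdn t p = 1%N by apply/eqP; rewrite -/(coprime _ _) coprime_sym prime_coprime.
  have Kv : K (x ^+ (v * p)) by apply/sHK/Hxp.2; rewrite dvdn_mull.
  apply/(subgroupMl sgK _ Kv); rewrite -expgSr -addn1 -gcd1 -uv mulnC expgnA.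
  exact: subgroupX.
apply/seteqP; split=> // h _; have [s xs] := Hxp.1 h.
by rewrite -(mulVKg (x ^+ s) h); apply: subgroupM => //; [apply: subgroupX|apply: sHK].
Qed.

End CyclicTransversal.

(** * Maximal subgroups of finite index have prime index and a cyclic transversal *)

Section MaximalSubgroups.
Local Open Scope group_scope.
Variables (G : groupType) (M : set G) (x : G).
Hypothesis sgM : subgroup M.
(* Every element of [M] maps each coset [x^s M] to itself or to [x^-s M]. *)
Hypothesis Mx : forall m s, M m -> M (x ^- s * m * x ^+ s) \/ M (x ^+ s * m * x ^+ s).

(** The set is [<x^d> M]. A quotient of two of its elements has the form [x^(d a) m x^(-d b)] with
    [m] in [M], and [m] sends the coset of [x^(-d b)] to that of [x^(-d b)] or [x^(d b)]. *)
Lemma subgroup_powers d p : (0 < p)%N -> M (x ^+ p) ->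
  subgroup [set g | exists t, eqcoset M (x ^+ (d * t)) g].
Proof.
move=> p_gt0 Mp; apply/subgroupP; split.
  by exists 0%N; rewrite muln0; apply: eqcoset_refl.
move=> g h [a xg] [b xh].
have Mpt t : M (x ^+ (p * t)) by rewrite expgnA; apply: subgroupX.
(* Exponents are naturals: since [x^p] lies in [M], the coset of [x^-t] is also that of
   [x^(t (p-1))]. *)
have negE t : x ^- t = x ^+ (t * p.-1) * (x ^+ (p * t))^-1.
  by rewrite -{2}(prednK p_gt0) mulSn [(t * _)%N]mulnC expgnDr invgM mulgA mulgV mul1g.
pose s := (d * b * p.-1)%N.
set mg := (x ^+ (d * a))^-1 * g in xg; set mh := (x ^+ (d * b))^-1 * h in xh.
have ghE : g / h = x ^+ (d * a) * (mg / mh) * x ^+ s * (x ^+ (p * (d * b)))^-1.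
  by rewrite -!mulgA -negE /mg /mh invgM invgK !mulgA mulgV mul1g mulgK.
have Mm : M (mg / mh) by apply: subgroupM => //; apply: subgroupV.
have tail y : eqcoset M y (g / h) <->
    eqcoset M y (x ^+ (d * a) * (mg / mh) * x ^+ s).
  rewrite ghE /eqcoset mulgA; apply: subgroupMr => //.
  exact: subgroupV.
case: (Mx s Mm) => Ms.
  exists (a + b * p.-1)%N; apply/tail; rewrite mulnDr mulnA expgnDr -mulgA.
  by apply/eqcosetMl; rewrite /eqcoset mulgA.
exists (a + b * p.-1 * p.-1)%N; apply/tail; rewrite mulnDr !mulnA expgnDr -mulgA.
apply/eqcosetMl; rewrite -/s; apply: (eqcoset_trans sgM (h := x ^- s)).
  by rewrite negE; apply: eqcosetMr; apply: subgroupV.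
by rewrite /eqcoset invgK mulgA.
Qed.

(** Let [p] be the least positive exponent with [x^p] in [M]. If [p] does not divide [d], then
    [<x^d> M] contains [x^d], which is outside [M], so it is the whole group. Taking [d = 1] gives
    the transversal, and taking [d] a proper divisor of [p] gives primality. *)
Lemma maximal_cyclic_transversal n :
    maximal_subgroup M -> has_index M n -> ~ M x ->
  prime n /\ cyclic_transversal M x n.
Proof.
move=> [_ _ maxM] Mn nMx.
have exP : exists s, (0 < s)%N && `[< M (x ^+ s) >].
  by have [s s0 Ms] := has_index_power sgM x Mn; exists s; rewrite s0; apply/asboolP.
case: (ex_minnP exP) => p /andP[p_gt0 /asboolP Mp] minp {exP}.
have Mdvd t : M (x ^+ t) <-> p %| t.
  split=> [|/dvdnP[u ->]]; last by rewrite mulnC expgnA; apply: subgroupX.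
  rewrite (divn_eq t p) mulnC expgnDr expgnA dvdn_addr ?dvdn_mulr //.
  move/(subgroupMl sgM _ (subgroupX sgM _ Mp)) => Mt.
  rewrite /dvdn modn_mod; apply: contraTT isT => nz.
  have := minp (t %% p)%N; rewrite lt0n nz asboolT // => /(_ isT).
  by rewrite leqNgt ltn_mod p_gt0.
pose K d := [set g | exists t, eqcoset M (x ^+ (d * t)) g].
have KT d : ~ (p %| d) -> K d = [set: G].
  move=> pd.
  have [||KM|//] := maxM (K d); first exact: subgroup_powers p_gt0 Mp.
    by move=> g Mg; exists 0%N; rewrite /eqcoset muln0 invg1 mul1g.
  case: pd; apply/Mdvd; rewrite -KM.
  by exists 1%N; rewrite muln1; apply: eqcoset_refl.
have p_neq1 : p != 1%N by apply: contra_notN nMx => /eqP p1; rewrite p1 in Mp.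
have xMp : cyclic_transversal M x p.
  split=> // g; have : K 1%N g by rewrite KT //; rewrite dvdn1; apply/negP.
  by case=> t; rewrite mul1n; exists t.
have p_pr : prime p.
  apply/primeP; split=> [|d dvd_dp]; first by rewrite ltn_neqAle eq_sym p_neq1.
  have [->|neq_dp] := eqVneq d p; first by rewrite orbT.
  have : K d x.
    rewrite KT //; apply/negP; apply: contra neq_dp => dvd_pd.
    by rewrite eqn_dvd dvd_dp.
  (* Now [d * t = 1] modulo [p], hence modulo its divisor [d], which forces [d = 1]. *)
  case=> t; rewrite -{2}(expg1 x) => /(eqcoset_expg sgM xMp) eq_t.
  have : d * t == 1 %[mod d] by rewrite -(modn_dvdm _ dvd_dp) eq_t modn_dvdm.
  by rewrite modnMr eq_sym -/(dvdn d 1) dvdn1 => ->.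
have -> // : n = p.
by apply: has_index_inj Mn _; apply: cyclic_transversal_index xMp _.
Qed.

End MaximalSubgroups.

(** * Letters of a presented group, and actions given on letters *)

Section PresentedGroup.
Local Open Scope group_scope.
Variables (T : choiceType) (R : set (word T)).
Notation G := (presented_group R).
Notation cls := (pres_class R).

Definition pres_letter (a : letter T) : G := cls [:: a].

Lemma pres_class_nil : cls [::] = 1 :> G.
Proof. by []. Qed.

Lemma pres_class_cat u v : cls (u ++ v) = cls u * cls v :> G.
Proof. by rewrite -pres_class_mul. Qed.

Lemma pres_class_cons a w : cls (a :: w) = pres_letter a * cls w :> G.
Proof. by rewrite -pres_class_cat. Qed.

Lemma pres_letterV a : pres_letter (inv_letter a) = (pres_letter a)^-1 :> G.
Proof.
symmetry; apply: mulg1_eq; rewrite -pres_class_cat.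
by apply/pres_classP; apply: (@pres_cancel _ _ [::] a [::]).
Qed.

Lemma pres_class_ind (P : G -> Prop) :
  P 1 -> (forall a g, P g -> P (pres_letter a * g)) -> forall g, P g.
Proof.
move=> P1 Pa g; rewrite -[g]pres_reprK; elim: (pres_repr g) => [//|a w IHw].
by rewrite pres_class_cons; apply: Pa.
Qed.

Lemma pres_class_relator r : R r -> cls r = 1 :> G.
Proof.
move=> Rr; apply/pres_classP.
by have := @pres_relator _ R [::] r [::] Rr; rewrite cats0.
Qed.

Section WordAction.
Variables (X : Type) (act : letter T -> X -> X).

Definition word_act (w : word T) (t : X) : X := foldr act t w.

Lemma word_act_cat u v t : word_act (u ++ v) t = word_act u (word_act v t).
Proof. exact: foldr_cat. Qed.

Hypothesis actK : forall a t, act a (act (inv_letter a) t) = t.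
Hypothesis actR : forall r t, R r -> word_act r t = t.

(** Cancellations and relators both act trivially, so the action on words descends to the presented
    group. *)
Lemma word_act_equiv u v : pres_equiv R u v -> word_act u =1 word_act v.
Proof.
elim=> {u v} [|u v _ uv t|v u w _ uv _ vw t|u a v t|u r v Rr t] //.
- by rewrite uv vw.
- by rewrite !word_act_cat /= actK.
- by rewrite !word_act_cat (actR _ Rr).
Qed.

Definition pres_act (g : G) := word_act (pres_repr g).

Lemma pres_act_class w : pres_act (cls w) =1 word_act w.
Proof. by apply/word_act_equiv/pres_classP; rewrite pres_reprK. Qed.

Lemma pres_act1 t : pres_act 1 t = t.
Proof. exact: pres_act_class. Qed.

Lemma pres_actM g h t : pres_act (g * h) t = pres_act g (pres_act h t).
Proof.
rewrite -[g]pres_reprK -[h]pres_reprK -[_ * _]pres_class_cat !pres_act_class.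
exact: word_act_cat.
Qed.

Lemma pres_actX g m t : pres_act (g ^+ m) t = iter m (pres_act g) t.
Proof.
by elim: m => [|m IHm]; rewrite ?pres_act1 // expgS pres_actM IHm.
Qed.

Lemma stabilizer_subgroup t0 : subgroup ([set g | pres_act g t0 = t0] : set G).
Proof.
apply/subgroupP; split=> [|g h gt ht]; first exact: pres_act1.
rewrite /= pres_actM -[RHS]gt -[in LHS]ht.
by rewrite -(pres_actM h^-1 h) mulVg pres_act1.
Qed.

End WordAction.
End PresentedGroup.

(** * Commutation in [Gk k] modulo the generators of large index *)

Section IteratedKlein.
Local Open Scope group_scope.
Variable k : nat.
Notation G := (Gk k).
Notation cls := (pres_class (@Gk_relators k)).
Notation lt := (pres_letter (@Gk_relators k)).

Implicit Types (i j : 'I_k) (b : bool).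

(** The relator says that conjugation by [x_i] inverts [x_j]; conjugation by the inverse of [x_i]
    then does so too. *)
Lemma Gk_letter_swap i j b b' : (i < j)%N ->
  lt (i, b) * lt (j, b') = lt (j, ~~ b') * lt (i, b) :> G.
Proof.
move=> lt_ij; set x := lt (i, true); set y := lt (j, true).
have xV : lt (i, false) = x^-1 :> G by rewrite -pres_letterV.
have yV : lt (j, false) = y^-1 :> G by rewrite -pres_letterV.
have xy : x * y = y^-1 * x :> G.
  have : x * (y * (x^-1 * y)) = 1 :> G.
    have := @pres_class_relator _ (@Gk_relators k)
      [:: (i, true); (j, true); (i, false); (j, true)] _.
    rewrite !pres_class_cons pres_class_nil mulg1 xV; apply.
    by exists i, j.
  move/(congr1 (fun g : G => g * y^-1 * x)); rewrite !mulgA mul1g.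
  by rewrite mulgK mulgVK.
have xyV : x * y^-1 = y * x :> G.
  by apply: (mulgI y^-1); rewrite mulKg mulgA -xy mulgK.
case: b b' => [] [] /=; rewrite ?xV ?yV //.
  by apply: (mulgI x); rewrite mulVKg mulgA xyV mulgK.
by apply: (mulgI x); rewrite mulVKg mulgA xy mulgK.
Qed.

(** The normal subgroup [N] of the overview: words in the letters above [j] already form a subgroup,
    and [upper_conj] shows that it is normal. *)
Definition upper j : set G :=
  [set g | exists2 w : word 'I_k, all (fun a : letter 'I_k => j < a.1)%N w & g = cls w].

Lemma upper_letter j (a : letter 'I_k) : (j < a.1)%N -> upper j (lt a).
Proof. by move=> ja; exists [:: a] => //=; rewrite ja. Qed.

Lemma upper_subgroup j : subgroup (upper j).
Proof.
have upM g h : upper j g -> upper j h -> upper j (g * h).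
  move=> [u ju ->] [v jv ->]; exists (u ++ v); first by rewrite all_cat ju.
  by rewrite pres_class_cat.
apply/subgroupP; split=> [|g h jg [v jv ->]]; first by exists [::].
apply: (upM _ _ jg); elim: v jv => [_|a v IHv /andP[ja jv]].
  by exists [::] => //; apply: (@invg1 G).
rewrite pres_class_cons (@invgM G); apply: upM; first exact: IHv.
by rewrite -pres_letterV; apply: upper_letter.
Qed.

Lemma upper_sub j (M : set G) : subgroup M ->
  (forall i, (j < i)%N -> M (lt (i, true))) -> upper j `<=` M.
Proof.
move=> sgM Mj _ [w jw ->]; elim: w jw => [_|[i b] w IHw /andP[ji jw]].
  exact: (subgroup1 sgM).
rewrite pres_class_cons; apply: (subgroupM sgM _ (IHw jw)); case: b ji => ji.
  exact: Mj.
rewrite -[(i, false)]/(inv_letter (i, true)) pres_letterV.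
by apply: (subgroupV sgM); exact: Mj.
Qed.

(** Induction on [g] and on a word for the element reduces to conjugating one letter above [j] by a
    letter [a]. If [a] is above [j] the result is a product inside [upper j]; otherwise the letter
    is inverted. *)
Lemma upper_conj j g n : upper j n -> upper j (g * n * g^-1).
Proof.
have sgN := upper_subgroup j.
move=> Nn; elim/pres_class_ind: g => [|a g IHg]; first by rewrite invg1 mulg1 mul1g.
rewrite invgM !mulgA -2!(mulgA (lt a)).
case: IHg => w jw ->; elim: w jw => [_|c w IHw /andP[jc jw]].
  by rewrite pres_class_nil mulg1 mulgV; apply: subgroup1.
have Na : upper j (lt a * lt c * (lt a)^-1).
  have [ja|aj] := ltnP j a.1.
    apply: (subgroupM sgN); last by apply: (subgroupV sgN); apply: upper_letter.
    by apply: (subgroupM sgN); apply: upper_letter.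
  case: a {IHw} aj => i b /= ij; case: c jc => l c /= jl.
  rewrite Gk_letter_swap ?mulgK; last exact: leq_ltn_trans jl.
  exact: upper_letter.
rewrite pres_class_cons.
have := subgroupM sgN Na (IHw jw).
by rewrite !mulgA mulgVK.
Qed.

Lemma upper_eqcosetMr j f g h :
  eqcoset (upper j) f g -> eqcoset (upper j) (f * h) (g * h).
Proof.
by move/(upper_conj h^-1); rewrite /eqcoset invgK invgM !mulgA.
Qed.

(** A letter below [j] inverts [x_j], a letter above [j] is trivial modulo [upper j], and a letter
    at [j] commutes with [x_j]. *)
Lemma letter_swap j (a : letter 'I_k) b : exists b',
  eqcoset (upper j) (lt a * lt (j, b)) (lt (j, b') * lt a).
Proof.
have sgN := upper_subgroup j.
case: (ltngtP a.1 j) => [aj|ja|/val_inj aj].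
- exists (~~ b); case: a aj => i c /= aj.
  by rewrite Gk_letter_swap //; apply: eqcoset_refl.
- exists b; have Na := upper_letter ja.
  rewrite /eqcoset invgM !mulgA; apply: subgroupM => //.
  rewrite -mulgA -{2}(invgK (lt (j, b))) mulgA.
  have := upper_conj (lt (j, b))^-1 (subgroupV sgN Na).
  by rewrite -!mulgA.
- exists b; case: a aj => i c /= ->.
  have V : lt (j, false) = (lt (j, true))^-1 by rewrite -pres_letterV.
  by case: c b => [] []; rewrite ?V ?mulgV ?mulVg; apply: eqcoset_refl.
Qed.

Lemma gen_swap j g b : exists b',
  eqcoset (upper j) (g * lt (j, b)) (lt (j, b') * g).
Proof.
have sgN := upper_subgroup j.
elim/pres_class_ind: g => [|a g [c IHg]].
  by exists b; rewrite mulg1 mul1g; apply: eqcoset_refl.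
have [c' ac] := letter_swap j a c; exists c'.
apply: (eqcoset_trans sgN (h := lt a * (lt (j, c) * g))).
  by rewrite -mulgA; apply/eqcosetMl.
by rewrite !mulgA; apply: upper_eqcosetMr.
Qed.

Lemma upper_swapX j g y z s : eqcoset (upper j) (g * y) (z * g) ->
  eqcoset (upper j) (g * y ^+ s) (z ^+ s * g).
Proof.
have sgN := upper_subgroup j.
move=> gy; elim: s => [|s IHs]; first by rewrite mulg1 mul1g; apply: eqcoset_refl.
rewrite !expgS mulgA; apply: (eqcoset_trans sgN (h := z * g * y ^+ s)).
  exact: upper_eqcosetMr.
by rewrite -!mulgA; apply/eqcosetMl.
Qed.

(** This is the hypothesis [Mx] for [x = x_j]: modulo [upper j], which lies in [M], [m x_j^s] equals
    [z^s m] with [z] either [x_j] or its inverse. *)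
Lemma subgroup_gen_conj j (M : set G) : subgroup M ->
    (forall i, (j < i)%N -> M (lt (i, true))) ->
  forall m s, M m -> M (lt (j, true) ^- s * m * lt (j, true) ^+ s) \/
                     M (lt (j, true) ^+ s * m * lt (j, true) ^+ s).
Proof.
move=> sgM Mj m s Mm; have [b /upper_swapX-/(_ s)] := gen_swap j m true.
move/(eqcoset_sym (upper_subgroup j))/(upper_sub sgM Mj).
rewrite invgM -mulgA => /(subgroupMl sgM _ (subgroupV sgM Mm)); rewrite mulgA.
case: b => Hm; first by left.
right; move: Hm; rewrite -[(j, false)]/(inv_letter (j, true)) pres_letterV.
by rewrite expVgn invgK.
Qed.

End IteratedKlein.

(** * Affine actions of [Gk k] on the field with [p] elements, and their stabilizers *)

Section AffineAction.
Variables (k p : nat).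
Hypothesis p_pr : prime p.
Local Open Scope ring_scope.
Import GRing.Theory.
Notation G := (Gk k).
Notation lt := (pres_letter (@Gk_relators k)).
Notation x_ j := (lt (j, true)).
Implicit Types (i j l : 'I_k) (d : {ffun 'I_k -> 'F_p}) (t : 'F_p).

(** Below [j] a generator and its inverse act alike, because [t |-> d_i - t] is an involution. *)
Definition klein_act j d (a : letter 'I_k) t : 'F_p :=
  if (a.1 < j)%N then d a.1 - t else
  if a.1 == j then (if a.2 then t + 1 else t - 1) else t.

(** The first clause normalizes the values of [d] that the action ignores, so that distinct pairs
    give distinct subgroups; the second expresses the relations between reflections. *)
Definition compatible j d : bool :=
  [forall i : 'I_k, (j <= i)%N ==> (d i == 0)] &&
  [forall i : 'I_k, forall l : 'I_k, (i < j)%N && (l < j)%N ==> (d i *+ 2 == d l *+ 2)].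

Lemma compatibleP j d :
  reflect ((forall i, (j <= i)%N -> d i = 0) /\
           (forall i l, (i < l)%N -> (l < j)%N -> d i *+ 2 = d l *+ 2))
          (compatible j d).
Proof.
apply: (iffP andP) => [[/forallP d0 /forallP d2]|[d0 d2]].
  split=> [i /(implyP (d0 i))/eqP//|i l il lj].
  by apply/eqP; have /forallP/(_ l) := d2 i; rewrite lj (ltn_trans il lj).
split; first by apply/forallP => i; apply/implyP => /d0->.
apply/forallP => i; apply/forallP => l; apply/implyP => /andP[ij lj].
by case: (ltngtP i l) => [/d2->//|/d2->//|/val_inj->].
Qed.

Lemma klein_actK j d a t : klein_act j d a (klein_act j d (inv_letter a) t) = t.
Proof.
case: a => i b; rewrite /klein_act /=; case: (i < j)%N; first by rewrite subKr.
by case: (i == j) => //; case: b; rewrite ?subrK ?addrK.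
Qed.

(** Four reflections compose to a translation, whose vanishing is the condition in [compatible].
    This serves both to build the action and to derive compatibility from a given subgroup. *)
Lemma relator_act i l j d t : (i < l)%N -> (l < j)%N ->
  word_act (klein_act j d) [:: (i, true); (l, true); (i, false); (l, true)] t =
  d i *+ 2 - d l *+ 2 + t.
Proof.
by move=> il lj; rewrite /= /klein_act /= lj (ltn_trans il lj); ring.
Qed.

Lemma klein_actR j d r t : compatible j d ->
  Gk_relators r -> word_act (klein_act j d) r t = t.
Proof.
move=> /compatibleP[_ d2] [i [l [il ->]]].
have [lj|jl] := ltnP l j; first by rewrite relator_act // (d2 i l) // subrr add0r.
rewrite /= /klein_act /= [(l < j)%N]ltnNge jl /=.
(* For [l = j] the reflection [x_i] inverts the translation [x_j]; for [l > j] the letter [x_l] acts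
   trivially and [x_i] cancels its inverse. *)
case: (eqVneq l j) => [eq_lj|neq_lj]; first by rewrite -eq_lj il; ring.
by case: (i < j)%N; [rewrite subKr | case: (i == j); rewrite ?subrK].
Qed.

Definition klein_subgroup j d : set G :=
  [set g | pres_act (klein_act j d) g 0 = 0].

Section Compatible.
Variables (j : 'I_k) (d : {ffun 'I_k -> 'F_p}).
Hypothesis cjd : compatible j d.
Notation gact := (pres_act (klein_act j d)).

Lemma klein_pres_actM (g h : G) t : gact (g * h)%g t = gact g (gact h t).
Proof. by apply: pres_actM => *; [apply: klein_actK|apply: klein_actR]. Qed.

Lemma klein_pres_act_letter a t : gact (lt a) t = klein_act j d a t.
Proof. by apply: pres_act_class => *; [apply: klein_actK|apply: klein_actR]. Qed.

Lemma klein_pres_actX m t : gact (x_ j ^+ m)%g t = t + m%:R.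
Proof.
rewrite pres_actX => *; [|apply: klein_actK|exact: klein_actR].
elim: m => [|m IHm]; first by rewrite addr0.
by rewrite iterS IHm klein_pres_act_letter /klein_act /= ltnn eqxx -addrA -natr1.
Qed.

Lemma klein_subgroup_sub : subgroup (klein_subgroup j d).
Proof. by apply: stabilizer_subgroup => *; [apply: klein_actK|apply: klein_actR]. Qed.

(** Orbit and stabilizer: the coset of [g] is determined by the image of [0], and [x_j^m] sends [0]
    to [m]. *)
Lemma klein_eqcoset m g : eqcoset (klein_subgroup j d) (x_ j ^+ m)%g g <-> gact g 0 = m%:R.
Proof.
rewrite -{2}(mulVKg (x_ j ^+ m)%g g) klein_pres_actM klein_pres_actX.
rewrite /eqcoset /klein_subgroup /=; split=> [->|]; first by rewrite add0r.
by move/eqP; rewrite -subr_eq0 addrK => /eqP.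
Qed.

Lemma klein_cyclic_transversal : cyclic_transversal (klein_subgroup j d) (x_ j) p.
Proof.
split=> [g|m].
  by exists (gact g 0 : nat); apply/klein_eqcoset; rewrite natr_Zp.
rewrite /klein_subgroup /= klein_pres_actX add0r (dvdn_pcharf (pchar_Fp p_pr)).
by split=> /eqP.
Qed.

End Compatible.

(** The subgroup determines [j] as the last index whose generator moves [0], and then [d_i] for
    [i < j] as the coset of [x_i]. *)
Lemma klein_subgroup_inj j d j' d' : compatible j d -> compatible j' d' ->
  klein_subgroup j d = klein_subgroup j' d' -> j = j' /\ d = d'.
Proof.
move=> cd cd' eqK.
have gtK i l e : compatible i e -> (i < l)%N -> klein_subgroup i e (x_ l).
  move=> ce il; rewrite /klein_subgroup /= klein_pres_act_letter // /klein_act /=.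
  by rewrite ltnNge (ltnW il) /=; case: eqVneq il => [->|//]; rewrite ltnn.
have eqK' i e : compatible i e -> ~ klein_subgroup i e (x_ i).
  move=> ce; rewrite /klein_subgroup /= klein_pres_act_letter // /klein_act /=.
  by rewrite ltnn eqxx add0r => /eqP; rewrite oner_eq0.
have eqj : j = j'.
  case: (ltngtP j j') => [jj'|jj'|/val_inj//].
    by case: (eqK' j' d' cd'); rewrite -eqK; apply: gtK.
  by case: (eqK' j d cd); rewrite eqK; apply: gtK.
rewrite -{j'}eqj in cd' eqK *; split=> //; apply/ffunP => i.
have [ji|ij] := leqP j i.
  by case/compatibleP: cd => ->//; case/compatibleP: cd' => ->.
have : eqcoset (klein_subgroup j d) (x_ j ^+ (d i : nat))%g (x_ i).
  by apply/(klein_eqcoset cd); rewrite natr_Zp klein_pres_act_letter // /klein_act ij subr0.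
rewrite eqK => /(klein_eqcoset cd'); rewrite natr_Zp klein_pres_act_letter //.
by rewrite /klein_act ij subr0.
Qed.

Lemma klein_subgroup_maximal j d : compatible j d ->
  maximal_subgroups_of_index G p (klein_subgroup j d).
Proof.
move=> cd; have cK := klein_cyclic_transversal cd; have sK := klein_subgroup_sub cd.
split; first exact: cyclic_transversal_maximal cK _.
exact: cyclic_transversal_index cK (prime_gt0 p_pr).
Qed.

Lemma letter_powX i j m : (i < j)%N ->
  (x_ i * x_ j ^+ m = x_ j ^- m * x_ i)%g.
Proof.
move=> ij; have xij : (x_ i * x_ j = (x_ j)^-1 * x_ i)%g.
  by rewrite Gk_letter_swap // -pres_letterV.
elim: m => [|m IHm]; first by rewrite invg1 mul1g mulg1.
by rewrite expgS mulgA xij -mulgA IHm mulgA -invgM -expgSr expgS.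
Qed.

(** * Recovering the affine action from the cosets of a subgroup *)

Section Completeness.
Variables (M : set G) (j : 'I_k).
Hypotheses (sgM : subgroup M) (Mxp : cyclic_transversal M (x_ j) p).
Hypothesis Mgt : forall i, (j < i)%N -> M (x_ i).

Lemma eqcoset_Fp a b :
  eqcoset M (x_ j ^+ a)%g (x_ j ^+ b)%g <-> a%:R = b%:R :> 'F_p.
Proof.
rewrite (eqcoset_expg sgM Mxp) -!(val_Fp_nat p_pr).
by split=> [/val_inj|->].
Qed.

(** Left multiplication on cosets, read through [t |-> x_j^t M], is the affine action. For [i < j]
    the reason is [x_i x_j^t = x_j^-t x_i], with [x_i] in the coset of [x_j^(d_i)]. *)
Lemma klein_act_letter d a t :
    (forall i, (i < j)%N -> eqcoset M (x_ j ^+ (d i : nat))%g (x_ i)) ->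
  eqcoset M (x_ j ^+ (klein_act j d a t : nat))%g (lt a * x_ j ^+ (t : nat))%g.
Proof.
move=> Md; suff act_pos i s : eqcoset M (x_ j ^+ (klein_act j d (i, true) s : nat))%g
                                (x_ i * x_ j ^+ (s : nat))%g.
  (* An inverse letter reduces to the positive one at the point [klein_act j d (i, false) t]. *)
  case: a => i [//|]; apply/(eqcosetMl _ (x_ i)); apply: (eqcoset_sym sgM).
  rewrite -[(i, false)]/(inv_letter (i, true)) pres_letterV mulVKg.
  by have := act_pos i (klein_act j d (i, false) t); rewrite klein_actK.
rewrite /klein_act /=; have [ij|ji] := ltnP i j.
  rewrite letter_powX //; apply/(eqcosetMl _ (x_ j ^+ (s : nat))%g).
  rewrite mulVKg -expgnDr; apply: (eqcoset_trans sgM) (Md i ij).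
  by apply/eqcoset_Fp; rewrite natrD !natr_Zp addrCA subrr addr0.
case: eqVneq => [->|neq_ij].
  by rewrite -expgS; apply/eqcoset_Fp; rewrite -natr1 !natr_Zp.
(* Here [i > j]: a conjugate of [x_i] by a power of [x_j] stays in [upper j], hence in [M]. *)
rewrite /eqcoset mulgA; apply: (upper_sub sgM Mgt).
rewrite -{2}(invgK (x_ j ^+ _)%g); apply: upper_conj; apply: upper_letter.
by rewrite /= ltn_neqAle ji eq_sym (inj_eq val_inj) neq_ij.
Qed.

Lemma klein_act_word d w t :
    (forall i, (i < j)%N -> eqcoset M (x_ j ^+ (d i : nat))%g (x_ i)) ->
  eqcoset M (x_ j ^+ (word_act (klein_act j d) w t : nat))%g
    (pres_class (@Gk_relators k) w * x_ j ^+ (t : nat))%g.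
Proof.
move=> Md; elim: w => [|a w IHw]; first by rewrite mul1g; apply: eqcoset_refl.
rewrite pres_class_cons -mulgA.
apply: (eqcoset_trans sgM) (klein_act_letter a _ Md) _.
exact/eqcosetMl.
Qed.

Lemma transversal_klein_subgroup :
  exists2 d, compatible j d & M = klein_subgroup j d.
Proof.
have [u Mu] := choice (fun i : 'I_k => Mxp.1 (x_ i)).
pose d := [ffun i : 'I_k => if (i < j)%N then (u i)%:R else 0 : 'F_p].
have Md i : (i < j)%N -> eqcoset M (x_ j ^+ (d i : nat))%g (x_ i).
  move=> ij; apply: (eqcoset_trans sgM) (Mu i).
  by apply/eqcoset_Fp; rewrite natr_Zp ffunE ij.
exists d.
  apply/compatibleP; split=> [i ji|i l il lj]; first by rewrite ffunE ltnNge ji.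
  (* The relator is [1] in the group, so it fixes the coset [M], and the translation by
     [2 d_i - 2 d_l] is zero. *)
  have := klein_act_word [:: (i, true); (l, true); (i, false); (l, true)] 0 Md.
  rewrite pres_class_relator ?mul1g; last by exists i, l.
  move/eqcoset_Fp; rewrite !natr_Zp relator_act // addr0 => /eqP.
  by rewrite subr_eq0 => /eqP.
have xg (g : G) : eqcoset M (x_ j ^+ (pres_act (klein_act j d) g 0 : nat))%g g.
  have := klein_act_word (pres_repr g) 0 Md.
  by rewrite [pres_class _ _]pres_reprK [(x_ j ^+ _)%g in X in eqcoset _ _ X]expg0 mulg1.
have M1 g : M g <-> eqcoset M (x_ j ^+ 0)%g g by rewrite /eqcoset invg1 mul1g.
apply/seteqP; split=> g; rewrite /klein_subgroup /=.
  move=> /M1/(eqcoset_sym sgM) g1.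
  by have /eqcoset_Fp := eqcoset_trans sgM (xg g) g1; rewrite natr_Zp.
by move=> g0; apply/M1; have := xg g; rewrite g0.
Qed.

End Completeness.
End AffineAction.

(** * Classification of the maximal subgroups of finite index *)

Lemma maximal_is_klein_subgroup k n (M : set (Gk k)) :
    maximal_subgroup M -> has_index M n ->
  prime n /\ exists (j : 'I_k) (d : {ffun 'I_k -> 'F_n}),
    compatible j d /\ M = klein_subgroup j d.
Proof.
move=> maxM Mn; have [sgM MT _] := maxM.
pose x i := pres_letter (@Gk_relators k) (i, true).
have [i0 nMi0] : exists i, ~ M (x i).
  apply: contrapT => noi; apply: MT; apply/seteqP; split=> // g _.
  have Mx i : M (x i) by apply: contrapT => nMi; apply: noi; exists i.
  elim/pres_class_ind: g => [|[i b] g Mg]; first exact: subgroup1.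
  apply: (subgroupM sgM) Mg; case: b; first exact: Mx.
  rewrite -[(i, false)]/(inv_letter (i, true)) pres_letterV.
  exact/(subgroupV sgM)/Mx.
have [j /asboolP nMj maxj] :=
  @arg_maxnP _ i0 (fun i => `[< ~ M (x i) >]) (@nat_of_ord k) (asboolT nMi0).
have Mgt (i : 'I_k) : (j < i)%N -> M (x i).
  by move=> ji; apply: contrapT => /asboolP/maxj; rewrite /= leqNgt ji.
have [n_pr Mxn] := maximal_cyclic_transversal sgM (subgroup_gen_conj sgM Mgt) maxM Mn nMj.
split=> //; have [d cd ->] := transversal_klein_subgroup n_pr sgM Mxn Mgt.
by exists j, d.
Qed.

(** * Counting the compatible pairs *)

Section Count.
Variables (k p : nat).
Hypothesis p_pr : prime p.
Local Open Scope ring_scope.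
Import GRing.Theory.

Definition compatible_pairs : {set 'I_k * {ffun 'I_k -> 'F_p}} :=
  [set jd | compatible jd.1 jd.2]%SET.

Lemma m_is_compatible_pairs : m_is (Gk k) p #|compatible_pairs|.
Proof.
pose F (jd : 'I_k * {ffun 'I_k -> 'F_p}) := klein_subgroup jd.1 jd.2.
rewrite /m_is.
have -> : maximal_subgroups_of_index (Gk k) p =
    (fun a : 'I_#|compatible_pairs| => F (enum_val a)) @` [set: _].
  apply/seteqP; split=> [M [maxM Mp]|_ [a _ <-]].
    have [_ [j [d [cd ->]]]] := maximal_is_klein_subgroup maxM Mp.
    have jdP : (j, d) \in compatible_pairs by rewrite inE.
    by exists (enum_rank_in jdP (j, d)); rewrite ?enum_rankK_in.
  apply: klein_subgroup_maximal => //.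
  by have := enum_valP a; rewrite inE.
apply: (card_eq_trans _ (_ : [set: 'I_#|compatible_pairs|] #= _)).
  apply: inj_card_eq => a b _ _ eqF; apply: enum_val_inj.
  have := enum_valP a; have := enum_valP b; rewrite !inE => cb ca.
  have [ej ed] := klein_subgroup_inj ca cb eqF.
  by rewrite [LHS]surjective_pairing ej ed -surjective_pairing.
by rewrite card_eq_sym; apply: card_II.
Qed.

Lemma card_compatible_pairs :
  #|compatible_pairs| = (\sum_(j < k) #|[set d : {ffun 'I_k -> 'F_p} | compatible j d]%SET|)%N.
Proof.
rewrite -sum1_card; under [RHS]eq_bigr => j _ do rewrite -sum1_card.
by rewrite pair_big_dep /=; apply: eq_bigl => jd; rewrite !inE.
Qed.

(** Since [2] is invertible, [d] is constant on the indices below [j]. That constant is free when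
    [j > 0]; for [j = 0] there are no such indices and only [d = 0] remains. *)
Lemma card_compatible_odd (j : 'I_k) : (2 < p)%N ->
  #|[set d : {ffun 'I_k -> 'F_p} | compatible j d]%SET| = (if j == 0 :> nat then 1 else p)%N.
Proof.
move=> p_gt2; have k_gt0 : (0 < k)%N by apply: leq_trans (ltn_ord j).
pose i0 := Ordinal k_gt0.
pose f (c : 'F_p) := [ffun i : 'I_k => if (i < j)%N then c else 0].
have -> : [set d | compatible j d]%SET = f @: [set: 'F_p]%SET.
  apply/setP => d; rewrite inE; apply/compatibleP/imsetP => [[d0 d2]|[c _ ->]]; last first.
    split=> [i ji|i l il lj]; first by rewrite ffunE ltnNge ji.
    by rewrite !ffunE lj (ltn_trans il lj).
  exists (d i0) => //; apply/ffunP => i; rewrite ffunE.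
  have [ij|/d0//] := ltnP i j.
  case: (posnP i) => [i_eq0|i_gt0]; first by congr (d _); apply: val_inj.
  have /eqP := d2 i0 i i_gt0 ij.
  rewrite -subr_eq0 -mulrnBl -mulr_natr mulf_eq0 orbC.
  rewrite -(dvdn_pcharf (pchar_Fp p_pr)) gtnNdvd //= subr_eq0.
  by move/eqP->.
case: eqP => [j0|/eqP j_neq0].
  have -> : f @: [set: 'F_p]%SET = [set f 0]%SET; last by rewrite cards1.
  apply/setP => d; rewrite inE; apply/imsetP/eqP => [[c _ ->]|->].
    by apply/ffunP => i; rewrite !ffunE j0.
  by exists 0.
rewrite card_imset ?cardsT ?card_Fp // => c c' /ffunP.
by move=> /(_ i0); rewrite !ffunE /= lt0n j_neq0.
Qed.

End Count.

(** In characteristic two the equations [2 d_i = 2 d_l] are void, so the [j] values below [j] are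
    arbitrary. *)
Lemma card_compatible_two k (j : 'I_k) :
  #|[set d : {ffun 'I_k -> 'F_2} | compatible j d]%SET| = 2 ^ j.
Proof.
have -> : [set d : {ffun 'I_k -> 'F_2} | compatible j d]%SET =
    [set d in pffun_on 0%R [pred i : 'I_k | i < j] predT]%SET.
  apply/setP => d; rewrite !inE; apply/compatibleP/pffun_onP.
    move=> [d0 _]; split=> [|//]; apply/fintype.subsetP => i; rewrite !inE ltnNge.
    by apply: contra => /d0->.
  move=> [/fintype.subsetP sd _]; split=> [i ji|i l _ _].
    by apply/eqP; apply: contraLR ji => /sd; rewrite !inE ltnNge.
  have c2 c : (c *+ 2)%R = 0%R :> 'F_2.
    by rewrite -GRing.mulr_natr pchar_Fp_0 ?GRing.mulr0.
  by rewrite !c2.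
rewrite cardsE card_pffun_on card_Fp //; congr (2 ^ _).
by rewrite -sum1_card (big_ord_narrow (ltnW (ltn_ord j))) sum1_card card_ord.
Qed.

Theorem theorem2p3 (k n : nat) (hk : 0 < k) (hn : 0 < n) :
  [/\ prime n -> 2 < n -> m_is (Gk k) n (1 + (k - 1) * n),
      n = 2 -> m_is (Gk k) n (\sum_(0 <= j < k) 2 ^ j) &
      ~~ prime n -> m_is (Gk k) n 0].
Proof.
split=> [n_pr n_gt2|->|n_npr].
- have := m_is_compatible_pairs k n_pr.
  rewrite card_compatible_pairs.
  under eq_bigr => j _ do rewrite card_compatible_odd //.
  case: k hk => // k' _.
  (* The index [j = 0] contributes [1] and each of the other [k - 1] indices contributes [n]. *)
  rewrite big_ord_recl /= subn1 /=.
  by under eq_bigr => j _ do rewrite /=; rewrite sum_nat_const card_ord.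
- have := m_is_compatible_pairs k (isT : prime 2).
  rewrite card_compatible_pairs big_mkord.
  by under eq_bigr => j _ do rewrite card_compatible_two.
rewrite /m_is II0 card_eq0; apply/eqP/seteqP; split=> // M [maxM Mn].
by case: (maximal_is_klein_subgroup maxM Mn) => n_pr; rewrite n_pr in n_npr.
Qed.
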